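(* Let $(\Omega,\mathcal A,\mathbb P)$ be a probability space, let $\beta\in[0,1)$, and set $r_\beta=\beta\delta_0+(1-\beta)\delta_{1/(1-\beta)}$ and $R_\beta=\{r_\beta\}$. Then for any $X\in\mathbb L^1(\Omega,\mathbb R)$, $$\mathrm{CV@R}_\beta(X)=\rho_{R_\beta}(X).$$
   Context: The conditional value at risk is $\mathrm{CV@R}_\beta(X)=\inf_{t\in\mathbb R}\big\{t+\frac1{1-\beta}\mathbb E[(X-t)_+]\big\}$, where $a_+=\max\{a,0\}$. Given a set $R$ of compactly supported Borel probability measures on $\mathbb R$, $\rho_R(X)=\chi_R(\mathbb P_X)$ where $\mathbb P_X$ is the law of $X$ and $\chi_R(m)=\sup_{\pi\in\Pi(m,R)}\int_{\mathbb R^2}xy\,\mathrm d\pi(x,y)$, with $\Pi(m,R)$ the set of Borel probability measures on $\mathbb R^2$ with first marginal $m$ and second marginal in $R$. *)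

(* Defs.v *)
From HB Require Import structures.
From mathcomp Require Export all_boot all_order all_algebra.
From mathcomp Require Export all_classical all_reals all_analysis.

Set Implicit Arguments.
Unset Strict Implicit.
Unset Printing Implicit Defensive.

Import Order.TTheory GRing.Theory Num.Theory.
Import numFieldNormedType.Exports.

Local Open Scope classical_set_scope.
Local Open Scope ring_scope.

Section cvar.
Context d (T : measurableType d) (R : realType) (P : probability T R).
Local Open Scope ereal_scope.

Definition cvar (b : R) (X : T -> R) : \bar R :=
  ereal_inf [set t%:E + ((1 - b)^-1)%:E * 'E_P[fun w => Num.max (X w - t)%R 0%R]
            | t in [set: R]].

End cvar.

Section coupling.
Context (R : realType).

Definition support (mu : probability R R) : set R :=
  [set x | forall U : set R, open U -> U x -> (0 < mu U)%E].

Definition compactly_supported (mu : probability R R) : Prop :=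
  compact (support mu).

(* Two measures of the library may differ outside the sigma-algebra, where
   their values carry no meaning, so marginals are compared on Borel sets only
   rather than by equality of set functions. *)
Definition couplings (m : probability R R) (Rs : set (probability R R)) :
    set (probability (R * R)%type R) :=
  [set pi | (forall A, measurable A -> pushforward pi fst A = m A) /\
            exists2 r, Rs r &
              forall A, measurable A -> pushforward pi snd A = r A].

(* Meant for sets Rs of compactly supported measures; for m with a finite first
   moment, x * y is then integrable against every coupling. *)
Definition chi (Rs : set (probability R R)) (m : probability R R) : \bar R :=
  ereal_sup [set (\int[pi]_z (z.1 * z.2)%:E)%E | pi in couplings m Rs].

Definition rho (Rs : set (probability R R)) d (T : measurableType d)
    (P : probability T R) (X : {RV P >-> R}) : \bar R :=
  chi Rs (distribution P X).

End coupling.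

Section r_beta.
Context (R : realType) (b : R) (hb : 0 <= b < 1).

Let b_ge0 : 0 <= b. Proof. by case/andP: hb. Qed.

Let onemb_ge0 : 0 <= 1 - b.
Proof. by case/andP: hb => _ /ltW; rewrite subr_ge0. Qed.

Definition r_beta : set R -> \bar R :=
  measure_add (mscale (NngNum b_ge0) (\d_(0 : R)))
              (mscale (NngNum onemb_ge0) (\d_((1 - b)^-1 : R))).

Let r_beta0 : r_beta set0 = 0%E. Proof. exact: measure0. Qed.

Let r_beta_ge0 A : (0 <= r_beta A)%E. Proof. exact: measure_ge0. Qed.

Let r_beta_sigma_additive : semi_sigma_additive r_beta.
Proof. exact: measure_semi_sigma_additive. Qed.

HB.instance Definition _ := isMeasure.Build _ _ _ r_beta
  r_beta0 r_beta_ge0 r_beta_sigma_additive.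

Lemma r_betaE (A : set R) :
  r_beta A =
    (b%:E * \d_(0%R : R) A + (1 - b)%R%:E * \d_((1 - b)^-1%R : R) A)%E.
Proof. by rewrite /r_beta measure_addE. Qed.

Let r_beta_setT : r_beta [set: R] = 1%E.
Proof.
by rewrite r_betaE !diracE !in_setT !mule1 -EFinD addrC subrK.
Qed.

HB.instance Definition _ := Measure_isProbability.Build _ _ _ r_beta r_beta_setT.

Definition R_beta : set (probability R R) := [set (r_beta : probability R R)].

Lemma R_beta_compactly_supported mu : R_beta mu -> compactly_supported mu.
Proof.
move=> ->; apply: finite_compact.
apply: (@sub_finite_set _ _ [set 0; (1 - b)^-1]) => [x sx|]; last first.
  exact: finite_set2.
apply: contrapT => xn.
have oU : open (~` [set (0 : R); (1 - b)^-1]).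
  by apply: closed_openC; apply: compact_closed => //;
    exact: finite_compact (finite_set2 _ _).
have := sx _ oU xn.
rewrite /= r_betaE !diracE !memNset ?mule0 ?adde0 ?ltxx //=.
- by move=> /(_ (or_intror erefl)).
- by move=> /(_ (or_introl erefl)).
Qed.

End r_beta.

(* Main.v *)
Require Import Defs.
From mathcomp Require Import measurable_realfun lra ring.

Set Implicit Arguments.
Unset Strict Implicit.
Unset Printing Implicit Defensive.

Import Order.TTheory GRing.Theory Num.Theory.
Import numFieldNormedType.Exports.

Local Open Scope classical_set_scope.
Local Open Scope ring_scope.

(** The identity is a transport duality. Put [c = 1 / (1 - b)] and let [m] be
the law of [X]. Under a coupling of [m] with [b \d_0 + (1 - b) \d_c] the second
coordinate [y] is almost surely [0] or [c], and equals [c] with probability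
[1 - b]. Hence, for every real [t],

  [x y <= t c 1_(y = c) + c (x - t)_+]   almost surely,

and the right-hand side, called [majorant] below, has integral
[t + c E (X - t)_+] whatever the coupling ([majorant_integral]). Taking the
supremum over couplings and the infimum over [t] gives [rho <= CV@R]
([xy_le_majorant], [rho_le_cvar]).

For the converse, the majorant is attained wherever [y = c] and [x >= t], or
[y = 0] and [x <= t] ([xy_eq_majorant]), so it is enough to find some [t] and a
coupling carried by that set. If [0 < b], a [b]-quantile [q] of [X]
([quantile_exists]) is such a [t]: [m] is the sum of a measure of mass [1 - b]
carried by [`[q, +oo[] and a measure of mass [b] carried by [`]-oo, q]], an atom
at [q] being shared between the two ([quantile_split]); the first is sent to
height [c] and the second to height [0] ([coupling_of_split]).

If [b = 0], a quantile may fail to exist, and the infimum defining CV@R may be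
reached only as [t] tends to [-oo]. But then [y = 1] almost surely, so the
coupling value is [E X], while [t + E (X - t)_+ = E max(X, t)] tends to [E X] by
dominated convergence ([cvar0_le_expectation]). *)

(** * Quantiles *)

(** The quantile is the infimum of the points where the distribution function
reaches [b]. Right-continuity of the distribution function gives the upper
inequality; the lower one follows by exhausting [`]-oo, q[] with closed
half-lines, on which the distribution function has not yet reached [b]. *)
Lemma quantile_exists (R : realType) (d : measure_display)
    (T : measurableType d) (P : probability T R) (X : {RV P >-> R}) (b : R) :
  0 < b < 1 ->
  exists q, (distribution P X `]-oo, q[ <= b%:E <= distribution P X `]-oo, q])%E.
Proof.
move=> /andP[b0 b1].
pose A := [set x | (b%:E <= cdf X x)%E].
have Nb1 : ~ (1 <= b%:E :> \bar R)%E by rewrite lee_fin leNgt b1.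
have Nb0 : ~ (b%:E <= 0 :> \bar R)%E by rewrite lee_fin leNgt b0.
have A0 : A !=set0.
  apply: contrapT => /set0P/negP/negPn/eqP A0; apply: Nb1.
  apply: cvge_le (@cvg_cdfy1 _ _ _ P X); apply: nearW => x.
  by apply/ltW; rewrite ltNge; apply/negP => bx; have : A x by []; rewrite A0.
have [M AM] : exists M, ~ A M.
  apply: contrapT => /forallNP AT; apply: Nb0.
  apply: cvge_ge (@cvg_cdfNy0 _ _ _ P X); apply: nearW => x.
  exact: contrapT (AT x).
have Alb : has_lbound A.
  exists M => x Ax; rewrite leNgt; apply/negP => /ltW xM; apply: AM.
  exact: le_trans Ax (cdf_nondecreasing X xM).
pose q := inf A; exists q; apply/andP; split.
- have -> : `]-oo, q[%classic = \bigcup_n `]-oo, q - n.+1%:R^-1]%classic.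
    apply/seteqP; split => [x|x [n _]] /=; rewrite !in_itv/=; last first.
      by move=> /le_lt_trans; apply; rewrite ltrBlDr ltrDl.
    rewrite -subr_gt0 => /ltr_add_invr[n]; rewrite add0r => nq.
    by exists n => //=; rewrite in_itv/= lerBrDl -lerBrDr; exact: ltW.
  have cvg_q := @nondecreasing_cvg_mu _ _ _ (distribution P X)
    (fun n => `]-oo, q - n.+1%:R^-1]%classic).
  apply: (cvge_le _ (cvg_q _ _ _)) => [|n||m n mn].
  + apply: nearW => n /=; rewrite leNgt; apply/negP => /ltW bn.
    have := ge_inf Alb bn; rewrite -/q.
    by rewrite lerDl oppr_ge0 leNgt invr_gt0 ltr0Sn.
  + exact: measurable_itv.
  + by apply: bigcup_measurable => n _; exact: measurable_itv.
  + apply/subsetPset; apply: subset_itvl.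
    by rewrite bnd_simp lerD2l lerN2 lef_pV2 ?posrE// ler_nat.
- apply: cvge_ge (@cdf_right_continuous _ _ _ P X q).
  near=> x.
  have qx : q < x by near: x; exact: nbhs_right_gt.
  have [a Aa ax] := inf_lt A0 qx.
  exact: le_trans Aa (cdf_nondecreasing X (ltW ax)).
Unshelve. all: by end_near. Qed.

(** An atom at [q] makes it impossible in general to cut [m] at [q] into pieces
of masses [1 - b] and [b] by restriction alone: the share [m `]-oo, q] - b] of
the atom goes to the upper piece and [b - m `]-oo, q[] to the lower one. The
quantile inequalities say that both shares are nonnegative. *)
Lemma quantile_split (R : realType) (m : probability R R) (b q : R) :
  (m `]-oo, q[%classic <= b%:E <= m `]-oo, q]%classic)%E ->
  exists m1 m0 : {measure set R -> \bar R},
    [/\ (forall A, measurable A -> m A = m1 A + m0 A)%E,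
        m1 setT = (1 - b)%:E, m0 setT = b%:E,
        m1 `]-oo, q[%classic = 0%E & m0 `]q, +oo[%classic = 0%E].
Proof.
move=> /andP[lb ub].
have mfin A : measurable A -> m A = (fine (m A))%:E.
  by move=> mA; rewrite fineK// fin_num_measure.
pose l := fine (m `]-oo, q[%classic).
pose u := fine (m `]-oo, q]%classic).
have lE : m `]-oo, q[%classic = l%:E by exact: mfin.
have uE : m `]-oo, q]%classic = u%:E by exact: mfin.
have a0 : 0 <= u - b by rewrite subr_ge0 -lee_fin -uE.
have b0 : 0 <= b - l by rewrite subr_ge0 -lee_fin -lE.
have lt_set1 : (`]-oo, q[ `&` [set q] = set0)%classic.
  by apply/seteqP; split=> // x /= [+ xq]; rewrite xq in_itv/= ltxx.
have le_split : (`]-oo, q] = `]-oo, q[ `|` [set q])%classic by rewrite setUitv1.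
have mset1 : m [set q] = (u - l)%:E.
  have : u%:E = (l%:E + m [set q])%E.
    by rewrite -uE -lE le_split measureU//.
  by rewrite (mfin [set q])// -EFinD => -[->]; congr EFin; lra.
have mright : m `]q, +oo[%classic = (1 - u)%:E.
  by rewrite -setCitvl probability_setC// uE.
pose above : {measure set R -> \bar R} :=
  measure_add (mrestr m (measurable_itv `]q, +oo[)) (mscale (NngNum a0) (\d_q)).
pose below : {measure set R -> \bar R} :=
  measure_add (mrestr m (measurable_itv `]-oo, q[)) (mscale (NngNum b0) (\d_q)).
have aboveE A : above A = (m (A `&` `]q, +oo[) + (u - b)%:E * \d_q A)%E.
  exact: measure_addE.
have belowE A : below A = (m (A `&` `]-oo, q[) + (b - l)%:E * \d_q A)%E.
  exact: measure_addE.
have line : (setT = `]q, +oo[ `|` `]-oo, q[ `|` [set q])%classic.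
  by rewrite -setUA -le_split setUC -setCitvl setUv.
have disj B C (A : set R) : B `&` C = set0 -> (A `&` B) `&` (A `&` C) = set0.
  by move=> BC; rewrite setIACA BC setI0.
have gt_lt : (`]q, +oo[ `&` `]-oo, q[ = set0)%classic.
  apply/seteqP; split=> // x /= []; rewrite !in_itv/= andbT => qx /(lt_trans qx).
  by rewrite ltxx.
have out_set1 : ((`]q, +oo[ `|` `]-oo, q[) `&` [set q] = set0)%classic.
  apply/seteqP; split=> // x /= [+ xq]; rewrite xq !in_itv/= andbT ltxx.
  by case.
have mset1I A : m (A `&` [set q]) = ((u - l) * (q \in A)%:R)%:E.
  have [qA|qA] := boolP (q \in A).
    by rewrite setIidr ?mulr1// => x ->; exact: set_mem.
  rewrite mulr0 -[RHS]/(0%E) -(measure0 m); congr (m _).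
  by apply/seteqP; split=> // x [/mem_set + xq]; rewrite xq; exact/negP.
exists above, below; split => [A mA||||].
- rewrite aboveE belowE -[in LHS](setIT A) line setIUr measureU; last 3 first.
  + by apply: measurableI => //; apply: measurableU.
  + exact: measurableI.
  + exact: disj.
  rewrite setIUr measureU; last 3 first.
  + exact: measurableI.
  + exact: measurableI.
  + exact: disj.
  rewrite [RHS]addeACA; congr (_ + _)%E.
  by rewrite -[LHS]/(m _) mset1I diracE -!EFinM -EFinD; congr EFin; ring.
- by rewrite aboveE setTI mright diracT mule1 -EFinD; congr EFin; lra.
- by rewrite belowE setTI lE diracT mule1 -EFinD; congr EFin; lra.
- rewrite aboveE diracE memNset ?mule0 ?adde0 //=; last by rewrite in_itv/= ltxx.
  by rewrite setIC gt_lt measure0.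
- rewrite belowE diracE memNset ?mule0 ?adde0 //=; last by rewrite in_itv/= ltxx.
  by rewrite gt_lt measure0.
Qed.

(** * Building couplings *)

(** Normalising by a total mass equal to [1] changes nothing; the Dirac mass at
[x] is the default value of the normalisation and shows that the space is
inhabited. *)
Lemma probability_of_measure (R : realType) (d : measure_display)
    (T : measurableType d) (mu : {measure set T -> \bar R}) (x : T) :
  mu setT = 1%E -> exists p : probability T R, forall A, p A = mu A.
Proof.
move=> mu1; exists (mnormalize mu (\d_x : probability T R)) => A.
by rewrite /= /mnormalize mu1 onee_eq0/= invr1 mule1.
Qed.

(** The definition is by tactic so that [mf] fills the measurability argument of
the measure structure on [pushforward mu f], which unification leaves open. *)
Definition image_measure (R : realType) d d' (T : measurableType d)
    (T' : measurableType d') (mu : {measure set T -> \bar R}) (f : T -> T')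
    (mf : measurable_fun setT f) : {measure set T' -> \bar R}.
Proof. by refine (pushforward mu f : {measure set T' -> \bar R}). Defined.

(** Sending [m1] to the height [1 / (1 - b)] and [m0] to the height [0] keeps
the first marginal [m1 + m0], and each height receives the full mass of the
piece sent to it. *)
Lemma coupling_of_split (R : realType) (b : R) (hb : 0 <= b < 1)
    (m : probability R R) (m1 m0 : {measure set R -> \bar R}) :
  (forall A, measurable A -> m A = m1 A + m0 A)%E ->
  m1 setT = (1 - b)%:E -> m0 setT = b%:E ->
  exists2 pi, couplings m (R_beta hb) pi &
    forall E, measurable E ->
    pi E = (m1 [set x | E (x, (1 - b)^-1)%R] + m0 [set x | E (x, 0%R)])%E.
Proof.
move=> mE m1T m0T.
have mpair (y : R) : measurable_fun setT (fun x : R => (x, y)).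
  exact: pair2_measurable.
pose push (mu : {measure set R -> \bar R}) y := image_measure mu (mpair y).
have [|p pE] := @probability_of_measure R _ _
    (measure_add (push m1 (1 - b)^-1) (push m0 0)) (0, 0).
  apply: etrans (measure_addE _ _ _) _; rewrite /= /pushforward !preimage_setT.
  by rewrite m1T m0T -EFinD subrK.
have pushE E :
    p E = (m1 [set x | E (x, (1 - b)^-1)%R] + m0 [set x | E (x, 0%R)])%E.
  by rewrite pE; exact: measure_addE.
exists p => [|E _]; last exact: pushE.
split => [A mA|]; first by rewrite /pushforward pushE mE.
exists (r_beta hb) => // A mA.
apply: etrans (esym (r_betaE hb A)); rewrite /pushforward pushE !diracE addeC.
have cstE (mu : {measure set R -> \bar R}) (y : R) :
    mu [set _ | A y] = (mu setT * (y \in A)%:R%:E)%E.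
  have [yA|yA] := boolP (y \in A); rewrite ?mule1 ?mule0.
    by congr (mu _); apply/seteqP; split => // x _; exact: set_mem.
  rewrite -[RHS](measure0 mu); congr (mu _).
  by apply/seteqP; split => // x /= /mem_set; exact/negP.
by rewrite -m1T -m0T; congr (_ + _)%E; exact: cstE.
Qed.

(** * The majorant of the product *)

(** Change of variables when the image measure is known on measurable sets
only, which is all that the marginal conditions of a coupling provide. *)
Lemma integral_image (R : realType) d d' (T : measurableType d)
    (T' : measurableType d') (mu : {measure set T -> \bar R})
    (nu : {measure set T' -> \bar R}) (phi : T -> T') (f : T' -> \bar R) :
  measurable_fun setT phi ->
  (forall A, measurable A -> pushforward mu phi A = nu A) ->
  nu.-integrable setT f ->
  mu.-integrable setT (f \o phi) /\
  (\int[mu]_x f (phi x) = \int[nu]_y f y)%E.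
Proof.
move=> mphi munu intf.
have /integrableP[mf absf] := intf.
have intphi : mu.-integrable setT (f \o phi).
  apply/integrableP; split; first exact: measurableT_comp.
  apply: le_lt_trans absf.
  have -> : (\int[nu]_x `|f x| = \int[pushforward mu phi]_x `|f x|)%E.
    by apply: eq_measure_integral => A mA _; rewrite -munu.
  rewrite ge0_integral_pushforward ?preimage_setT//.
  exact: measurableT_comp.
split => //; transitivity (\int[pushforward mu phi]_y f y)%E.
  by rewrite integral_pushforward ?preimage_setT.
by apply: eq_measure_integral => A mA _; exact: munu.
Qed.

Lemma measurable_xy (R : realType) :
  measurable_fun setT (fun z : R * R => (z.1 * z.2)%:E).
Proof. by apply/measurable_EFinP; exact: measurable_funM. Qed.

Section coupling_integral.
Context (R : realType) (b : R) (hb : 0 <= b < 1) (m : probability R R).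
Hypothesis intm : m.-integrable setT (EFin : R -> \bar R).
Variables (pi : probability (R * R)%type R) (cpl : couplings m (R_beta hb) pi).
Let c := (1 - b)^-1.

Let c_gt0 : 0 < c.
Proof. by rewrite invr_gt0 subr_gt0; case/andP: hb. Qed.

Let measurable_top : measurable (snd @^-1` [set c] : set (R * R)).
Proof. by rewrite -[X in measurable X]setTI; exact: measurable_snd. Qed.

Lemma coupling_snd_ae : {ae pi, forall z, z.2 = 0 \/ z.2 = c}.
Proof.
case: cpl => _ [_ -> sndE].
have mC : measurable (~` [set 0; c]).
  by apply: measurableC; apply: measurableU; exact: measurable_set1.
exists (snd @^-1` (~` [set 0; c])); split => //.
- by rewrite -[X in measurable X]setTI; exact: measurable_snd.
- apply: etrans (sndE _ mC) _; apply: etrans (r_betaE hb _) _.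
  rewrite !diracE !memNset ?mule0 ?adde0//=.
  + by move=> /(_ (or_intror erefl)).
  + by move=> /(_ (or_introl erefl)).
Qed.

Lemma coupling_snd_top : pi (snd @^-1` [set c]) = (1 - b)%:E.
Proof.
case: cpl => _ [_ -> sndE].
apply: etrans (sndE _ (measurable_set1 _)) _.
apply: etrans (r_betaE hb _) _.
have c0 : ((0 : R) \in [set c]) = false.
  by apply: memNset => /eqP; rewrite eq_sym gt_eqF.
by rewrite !diracE c0 mem_set// mule0 add0e mule1.
Qed.

Lemma coupling_fst_integral (f : R -> R) : m.-integrable setT (EFin \o f) ->
  pi.-integrable setT (fun z => (f z.1)%:E) /\
  (\int[pi]_z (f z.1)%:E = \int[m]_x (f x)%:E)%E.
Proof. by case: cpl => fstE _; exact: integral_image. Qed.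

Lemma integrable_pos_part t :
  m.-integrable setT (fun x => (Num.max (x - t) 0)%:E).
Proof.
have intt : m.-integrable setT (EFin \o cst t).
  exact: finite_measure_integrable_cst.
apply: (le_integrable _ _ _ (integrableB _ intm intt)) => //.
  apply/measurable_EFinP; apply: measurable_maxr => //; exact: measurable_funB.
move=> x _ /=; rewrite lee_fin.
by have [?|?] := leP (x - t) 0; rewrite ?normr0.
Qed.

(** The indicator of [y = c], multiplied by [c], stands for [y]: the two agree
almost surely, and with the indicator the bound on the product holds at every
point of the plane. *)
Definition majorant t (z : R * R) :=
  t * c * \1_(snd @^-1` [set c]) z + c * Num.max (z.1 - t) 0.

Lemma majorant_integral t :
  pi.-integrable setT (fun z => (majorant t z)%:E) /\
  (\int[pi]_z (majorant t z)%:E =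
   t%:E + c%:E * \int[m]_x (Num.max (x - t) 0)%:E)%E.
Proof.
have [intf fE] := coupling_fst_integral (integrable_pos_part t).
have int1 : pi.-integrable setT (EFin \o \1_(snd @^-1` [set c] : set (R * R))).
  exact: integrable_indic.
have intt := integrableZl measurableT (t * c) int1.
have intp := integrableZl measurableT c intf.
split; first exact: integrableD intt intp.
rewrite /majorant; under eq_integral do rewrite EFinD.
rewrite integralD//; congr (_ + _)%E.
  under eq_integral do rewrite EFinM.
  have topE : (\int[pi]_z (\1_(snd @^-1` [set c]) z)%:E = (1 - b)%:E)%E.
    by rewrite integral_indic// setIT; exact: coupling_snd_top.
  rewrite integralZl//= topE -EFinM -mulrA.
  by rewrite mulVf ?mulr1 // -invr_eq0 gt_eqF.
under eq_integral do rewrite EFinM.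
by rewrite integralZl// fE.
Qed.

(** Replacing [y] by [c 1_(y = c)] leaves the integral of the product unchanged
and makes the comparison with the majorant pointwise: where [y = c] it reads
[x <= t + (x - t)_+], and elsewhere [0 <= (x - t)_+]. *)
Lemma xy_le_majorant t :
  (\int[pi]_z (z.1 * z.2)%:E <= \int[pi]_z (majorant t z)%:E)%E.
Proof.
have mprod : measurable_fun setT
    (fun z : R * R => (c * z.1 * \1_(snd @^-1` [set c]) z)%:E).
  apply/measurable_EFinP; apply: measurable_funM => //; exact: measurable_funM.
rewrite (@ae_eq_integral _ _ _ pi setT
  (fun z => (c * z.1 * \1_(snd @^-1` [set c]) z)%:E))//; last 2 first.
- exact: measurable_xy.
- apply: filterS coupling_snd_ae => z z2 _; rewrite indicE; case: z2 => z2.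
    rewrite memNset ?z2 ?mulr0//= z2.
    by apply/eqP; rewrite eq_sym gt_eqF.
  by rewrite mem_set// z2 mulr1 mulrC.
apply: le_integral => //.
- have [intx _] := coupling_fst_integral intm.
  apply: (le_integrable measurableT mprod _
           (integrableZl measurableT c intx)) => // z _.
  rewrite -EFinM !abse_EFin lee_fin [leLHS]normrM ler_piMr//.
  by rewrite indicE; case: (_ \in _); rewrite ?normr1 ?normr0.
- by have [] := majorant_integral t.
- move=> z _; rewrite lee_fin /majorant indicE.
  have cmax : c * (z.1 - t) <= c * Num.max (z.1 - t) 0.
    by rewrite ler_pM2l// le_max lexx.
  have cmax0 : 0 <= c * Num.max (z.1 - t) 0.
    by apply: mulr_ge0; rewrite ?le_max ?lexx ?orbT// ltW.
  by case: (_ \in _); rewrite ?mulr1 ?mulr0 ?add0r//; lra.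
Qed.

(** Complementary slackness: a coupling is optimal as soon as, for some level
[t], the top height is used only above [t] and the bottom height only below. *)
Lemma xy_eq_majorant t :
  pi (~` (`[t, +oo[ `*` [set c] `|` `]-oo, t] `*` [set 0])) = 0%E ->
  (\int[pi]_z (z.1 * z.2)%:E = \int[pi]_z (majorant t z)%:E)%E.
Proof.
move=> pi0; apply: ae_eq_integral => //.
- exact: measurable_xy.
- by have [/measurable_int] := majorant_integral t.
- exists (~` (`[t, +oo[ `*` [set c] `|` `]-oo, t] `*` [set 0])); split => //.
    by apply: measurableC; apply: measurableU; apply: measurableX.
  apply: subsetC => -[x y] /= xy _; rewrite /majorant indicE/=.
  case: xy => -[/=]; rewrite in_itv/= ?andbT => xt ->.
    by rewrite mem_set//= max_l ?subr_ge0// mulr1; congr EFin; ring.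
  rewrite memNset/= ?mulr0 ?add0r ?max_r ?subr_le0 ?mulr0//.
  by apply/eqP; rewrite eq_sym gt_eqF.
Qed.

End coupling_integral.

(** * The two inequalities *)

Section duality.
Context (R : realType) d (T : measurableType d) (P : probability T R)
  (b : R) (hb : 0 <= b < 1) (X : {RV P >-> R}).
Hypothesis hX : (X : T -> R) \in Lfun P 1%E.
Let m : probability R R := distribution P X.

Let integrable_law : m.-integrable setT (EFin : R -> \bar R).
Proof.
apply: integrable_pushforward => //.
by rewrite preimage_setT; exact/Lfun1_integrable.
Qed.

Lemma expectation_pos_part t :
  ('E_P[fun w => Num.max (X w - t)%R 0%R] =
   \int[m]_x (Num.max (x - t)%R 0%R)%:E)%E.
Proof.
rewrite unlock ge0_integral_distribution//.
- apply/measurable_EFinP; apply: measurable_maxr => //; exact: measurable_funB.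
- by move=> y; rewrite lee_fin le_max lexx orbT.
Qed.

Lemma rho_le_cvar : (rho (R_beta hb) X <= cvar P b X)%E.
Proof.
apply: ge_ereal_sup => _ [pi cpl <-].
apply: le_ereal_inf_tmp => _ [t _ <-].
rewrite expectation_pos_part.
have [_ <-] := majorant_integral integrable_law cpl t.
exact: (xy_le_majorant integrable_law cpl).
Qed.

Lemma cvar_le_rho_pos : 0 < b -> (cvar P b X <= rho (R_beta hb) X)%E.
Proof.
move=> b0.
have [|q mq] := @quantile_exists _ _ _ P X b.
  by rewrite b0; case/andP: hb.
have [m1 [m0 [mE m1T m0T m1q m0q]]] := @quantile_split _ m _ _ mq.
have [pi cpl piE] := coupling_of_split hb mE m1T m0T.
apply: (@le_trans _ _ (\int[pi]_z (z.1 * z.2)%:E)%E); last first.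
  by apply: ereal_sup_ubound; exists pi.
rewrite (@xy_eq_majorant _ _ hb _ integrable_law _ cpl q).
  apply: ereal_inf_lbound; exists q => //.
  have [_ ->] := majorant_integral integrable_law cpl q.
  by rewrite expectation_pos_part.
have c0 : (1 - b)^-1 != 0.
  by rewrite invr_neq0// gt_eqF// subr_gt0; case/andP: hb.
rewrite piE; last first.
  by apply: measurableC; apply: measurableU; apply: measurableX.
(* Since the two heights differ, the slices of the complement at heights [c] and
   [0] are the open half-lines on which [m1] and [m0] vanish. *)
apply/eqP; rewrite -[eqbRHS]adde0 -{1}m1q -m0q; apply/eqP; congr (m1 _ + m0 _)%E.
- apply/seteqP; split=> x /=; rewrite !in_itv/= ?andbT.
    by rewrite ltNge => xq; apply/negP => qx; apply: xq; left.
  by move=> xq [[qx _]|[_ /eqP]]; [move: xq; rewrite ltNge qx|exact/negP].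
- apply/seteqP; split=> x /=; rewrite !in_itv/= ?andbT.
    by rewrite ltNge => xq; apply/negP => qx; apply: xq; right.
  move=> xq [[_ /eqP]|[qx _]]; first by rewrite eq_sym; exact/negP.
  by move: xq; rewrite ltNge qx.
Qed.

(** At [b = 0] the objective is [t + E (X - t)_+ = E max(X, t)]; it is evaluated
at [t = - n], where [max(X, - n)] is dominated by [|X|]. *)
Lemma cvar0_le_expectation : (cvar P 0 X <= \int[m]_x x%:E)%E.
Proof.
have intm := integrable_law.
have maxE (x t : R) : Num.max x t = t + Num.max (x - t) 0.
  by rewrite addr_maxr addrC subrK addr0.
have bnd n : (cvar P 0 X <= \int[m]_x (Num.max x (- n%:R)%R)%:E)%E.
  apply: ereal_inf_lbound; exists (- n%:R)%R => //.
  rewrite subr0 invr1 mul1e expectation_pos_part.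
  under [RHS]eq_integral do rewrite maxE EFinD.
  rewrite [RHS]integralD//.
  - congr (_ + _)%E; apply/esym; rewrite integral_cst//.
    exact: etrans (congr1 _ (probability_setT m)) (mule1 _).
  - exact: finite_measure_integrable_cst.
  - exact: integrable_pos_part.
have [|||||_ _ cvg_max] := @dominated_convergence _ _ _ m setT measurableT
  (fun n x => (Num.max x (- n%:R)%R)%:E) EFin (fun x => `|x%:E|%E).
- by move=> n; apply/measurable_EFinP; exact: measurable_maxr.
- exact: measurable_int intm.
- apply: nearW => x _; apply: cvg_near_cst; near=> n.
  congr EFin; apply/max_l; rewrite lerNl.
  by near: n; exact: nbhs_infty_ger.
- exact: integrable_abse.
- apply: nearW => x n _; rewrite lee_fin.
  have [xn|//] := leP x (- n%:R).
  by rewrite normrN normr_nat ler_normr lerNr xn orbT.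
by apply: cvge_ge cvg_max; apply: nearW.
Unshelve. all: by end_near. Qed.

(** The whole law goes to height [1], so the product is almost surely the first
coordinate. *)
Lemma cvar_le_rho0 : b = 0 -> (cvar P b X <= rho (R_beta hb) X)%E.
Proof.
move=> b0.
have [||| pi cpl piE] := @coupling_of_split _ _ hb m m mzero.
- by move=> A _; rewrite adde0.
- by rewrite b0 subr0; exact: (probability_setT m).
- by rewrite b0.
apply: (@le_trans _ _ (\int[pi]_z (z.1 * z.2)%:E)%E); last first.
  by apply: ereal_sup_ubound; exists pi.
have [intx xE] := coupling_fst_integral cpl integrable_law.
have mS : measurable (snd @^-1` (~` [set (1 : R)]) : set (R * R)).
  rewrite -[X in measurable X]setTI; apply: measurable_snd => //.
  by apply: measurableC.
rewrite (@ae_eq_integral _ _ _ pi setT (fun z => z.1%:E))//.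
- by rewrite xE b0; exact: cvar0_le_expectation.
- exact: measurable_xy.
- exact: measurable_int intx.
- exists (snd @^-1` (~` [set 1])); split => //.
    apply: etrans (piE _ mS) _; rewrite b0 subr0 invr1 adde0 -[RHS](measure0 m).
    by congr (m _); apply/seteqP; split => x //= /(_ erefl).
  by move=> [x y] /= xy y1; apply: xy => _; rewrite y1 mulr1.
Qed.

End duality.

Theorem proposition6p1 (R : realType) (d : measure_display)
    (T : measurableType d) (P : probability T R)
    (b : R) (hb : 0 <= b < 1)
    (X : {RV P >-> R}) (hX : (X : T -> R) \in Lfun P 1%E) :
  cvar P b X = rho (R_beta hb) X.
Proof.
apply/eqP; rewrite eq_le rho_le_cvar// andbT.
have /andP[b_ge0 _] := hb.
have [b_gt0|b_le0] := ltP 0 b; first exact: cvar_le_rho_pos.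
by apply: cvar_le_rho0 => //; apply/eqP; rewrite eq_le b_le0.
Qed.
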